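(* Let $b:\mathbb{R}^d\to\mathbb{R}^d$, $\sigma:\mathbb{R}^d\to\mathbb{R}^{d\times d}$ and an $\mathbb{R}^d$-valued random variable $\eta$ satisfy, for some constants $L,c,p_0,H,l>0$: (A1) $(b(x)-b(y))(x-y)\le -L|x-y|^2$ and $|\sigma(x)-\sigma(y)|\le c|x-y|$ for all $x,y\in\mathbb{R}^d$; (A2) $E|\eta|^{p_0}<\infty$; (A3) the function $g(x):=b(0)-b(x)-Lx$ satisfies $|g(x)-g(y)|\le H(1+|x|+|y|)^l|x-y|$ for all $x,y\in\mathbb{R}^d$. Put $s_n:=H^{-\frac1{l+1}}n^{\frac1{2(l+1)}}-1$. Then there exists $m\in\mathbb{N}$ such that $s_n\ge2$ for all $n\ge m$, and such that the functions $b_n:\mathbb{R}^d\to\mathbb{R}^d$, $n\ge m$, given by $$b_n(x):=b(0)-Lx-\tilde g_{n^{1/2},s_n,0}(x),$$ with the truncation $\tilde g_{R,r,x_0}$ defined in the context (with $R=n^{1/2}$, $r=s_n$, $x_0=0$), satisfy for all $n\ge m$: (i) $(b_n(x)-b_n(y))(x-y)\le -L|x-y|^2$ for all $x,y\in\mathbb{R}^d$. (ii) $|b_n(x)|\le L|x|+n^{1/2}\,(1+\min\{|x|,s_n\})$ for all $x\in\mathbb{R}^d$. (iii) Let $p>0$. For every $\mathbb{R}^d$-valued random variable $X$ with $E|X|^{p_0}<\infty$ there exists a constant $C=C(E|X|^{p_0})>0$, independent of $n$, such that $$E|b(X)-b_n(X)|^p\le C\,n^{\frac{(l+2)p-p_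0}{2(l+1)}}\,E|X|^{p_0}.$$
   Context: $xy$ denotes the Euclidean inner product of $x,y\in\mathbb{R}^d$ and $|\cdot|$ the Euclidean norm (and a fixed matrix norm on $\mathbb{R}^{d\times d}$). Truncation: for $g:\mathbb{R}^d\to\mathbb{R}^d$, $R>0$, $r\ge2$, $x_0\in\mathbb{R}^d$, set $\tilde g_{R,r,x_0}(x):=t(x)g(x)+R\,s(x)(x-x_0)$, where $$t(x)=\begin{cases}1,& |x-x_0|\le r-1,\\ r-|x-x_0|,& r-1<|x-x_0|<r,\\ 0,& |x-x_0|\ge r,\end{cases}\qquad s(x)=\begin{cases}0,&|x-x_0|\le r-2,\\ |x-x_0|-r+2,& r-2<|x-x_0|<r-1,\\ 1,& r-1\le|x-x_0|\le r,\\ \frac{r}{|x-x_0|},&|x-x_0|\ge r.\end{cases}$$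
   Formalization: In (iii), C depends on X only through E|X|^{p_0} when (l+1)p ≤ p_0; for other p>0 the claim is made only for X with E|b(X)-b_n(X)|^p finite for all n ≥ m, and C may depend on X (still not on n). As written (iii) fails for b(x)=-x-x^3 when E|X|^{3p} is infinite. *)

(* Defs.v *)
From HB Require Import structures.
From mathcomp Require Import all_boot all_order all_algebra.
From mathcomp Require Import all_classical all_reals all_analysis.

Set Implicit Arguments.
Unset Strict Implicit.
Unset Printing Implicit Defensive.

Import Order.TTheory GRing.Theory Num.Theory.
Import numFieldNormedType.Exports.

Local Open Scope classical_set_scope.
Local Open Scope ring_scope.

Definition dotp (R : realType) (d : nat) (x y : 'rV[R]_d) : R :=
  \sum_(i < d) x 0 i * y 0 i.

(* The library norm on 'rV[R]_d is the sup norm, hence a separate Euclidean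
   norm; both induce the same topology. *)
Definition enorm (R : realType) (d : nat) (x : 'rV[R]_d) : R :=
  Num.sqrt (dotp x x).

Definition is_norm (R : realType) (V : lmodType R) (N : V -> R) : Prop :=
  [/\ forall A, 0 <= N A,
      forall A, N A = 0 -> A = 0,
      forall (a : R) A, N (a *: A) = `|a| * N A &
      forall A B, N (A + B) <= N A + N B].

Definition borel_rV (R : realType) (d : nat) :=
  g_sigma_algebraType (@open 'rV[R]_d).

Definition abs_moment (R : realType) (d : nat) (disp : measure_display)
    (Omega : measurableType disp) (P : probability Omega R) (p : R)
    (Y : Omega -> 'rV[R]_d) : \bar R :=
  ('E_P[fun w => (enorm (Y w) `^ p)%R])%E.

Definition trunc_t (R : realType) (d : nat) (r : R) (x0 x : 'rV[R]_d) : R :=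
  let u := enorm (x - x0) in
  if u <= r - 1 then 1 else if u < r then r - u else 0.

Definition trunc_s (R : realType) (d : nat) (r : R) (x0 x : 'rV[R]_d) : R :=
  let u := enorm (x - x0) in
  if u <= r - 2 then 0
  else if u < r - 1 then u - r + 2
  else if u <= r then 1
  else r / u.

(* Meant for r >= 2 and M > 0; other values of r and M carry no meaning. *)
Definition trunc (R : realType) (d : nat) (g : 'rV[R]_d -> 'rV[R]_d)
    (M r : R) (x0 x : 'rV[R]_d) : 'rV[R]_d :=
  trunc_t r x0 x *: g x + (M * trunc_s r x0 x) *: (x - x0).

Definition drift_rest (R : realType) (d : nat) (b : 'rV[R]_d -> 'rV[R]_d)
    (L : R) (x : 'rV[R]_d) : 'rV[R]_d :=
  b 0 - b x - L *: x.

Definition trunc_radius (R : realType) (H l : R) (n : nat) : R :=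
  H `^ (- (l + 1)^-1) * n%:R `^ ((2 * (l + 1))^-1) - 1.

Definition trunc_drift (R : realType) (d : nat) (b : 'rV[R]_d -> 'rV[R]_d)
    (L H l : R) (n : nat) (x : 'rV[R]_d) : 'rV[R]_d :=
  b 0 - L *: x
    - trunc (drift_rest b L) (n%:R `^ (2^-1)) (trunc_radius H l n) 0 x.

(* Main.v *)
(* Write u = |x|, v = |y|, rho = |x - y| and let t, s be the two profiles of the
   truncation.  For u <= v the pairing of s(u) x - s(v) y with x - y equals
   ((s(u) + s(v)) rho^2 + (s(v) - s(u)) (v^2 - u^2)) / 2, a convex function of
   rho >= v - u.  Since t(u) + s(u) u is nondecreasing in u, this pairing
   dominates (t(u) - t(v)) rho; as |g| <= n^(1/2) on the ball of radius s_n, it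
   absorbs the only possibly negative term created by cutting off the monotone
   function g, and this gives (i).  For (ii), n^(1/2) = H (1 + s_n)^(l+1) leaves
   room for |b(0)| <= H (1 + s_n)^l, true for n large.  For (iii), b - b_n
   vanishes on the ball of radius s_n - 2, outside of which q = 4 u / (1 + s_n)
   is at least 1.  If (l+1) p <= p0, then |b - b_n| <= 2 H (1 + s_n)^(l+2) q^(l+1)
   and q^((l+1) p) <= q^p0.  Otherwise |b - b_n| <= |b - b_m| + 2 H (1 + s_n)^(l+2),
   and the contribution of |b - b_m|, a finite constant, is controlled because
   the exponent of n is positive. *)
Require Import Defs.
From HB Require Import structures.
From mathcomp Require Import all_boot all_order all_algebra.
From mathcomp Require Import all_classical all_reals all_analysis.
From mathcomp Require Import measurable_realfun ring lra.
Import Order.TTheory GRing.Theory Num.Theory.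
Import numFieldNormedType.Exports.
Local Open Scope classical_set_scope.
Local Open Scope ring_scope.

Set Implicit Arguments.
Unset Strict Implicit.
Unset Printing Implicit Defensive.

(** * Euclidean inner product and norm *)

Lemma dotpC (R : realType) (d : nat) (x y : 'rV[R]_d) : dotp x y = dotp y x.
Proof. by apply: eq_bigr => i _; rewrite mulrC. Qed.

Lemma dotpDl (R : realType) (d : nat) (x y z : 'rV[R]_d) :
  dotp (x + y) z = dotp x z + dotp y z.
Proof. by rewrite -big_split; apply: eq_bigr => i _; rewrite mxE mulrDl. Qed.

Lemma dotpZl (R : realType) (d : nat) (a : R) (x y : 'rV[R]_d) :
  dotp (a *: x) y = a * dotp x y.
Proof. by rewrite mulr_sumr; apply: eq_bigr => i _; rewrite mxE mulrA. Qed.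

Lemma dotpNl (R : realType) (d : nat) (x y : 'rV[R]_d) :
  dotp (- x) y = - dotp x y.
Proof. by rewrite -scaleN1r dotpZl mulN1r. Qed.

Lemma dotpBl (R : realType) (d : nat) (x y z : 'rV[R]_d) :
  dotp (x - y) z = dotp x z - dotp y z.
Proof. by rewrite dotpDl dotpNl. Qed.

Lemma dotpDr (R : realType) (d : nat) (x y z : 'rV[R]_d) :
  dotp z (x + y) = dotp z x + dotp z y.
Proof. by rewrite dotpC dotpDl !(dotpC z). Qed.

Lemma dotpZr (R : realType) (d : nat) (a : R) (x y : 'rV[R]_d) :
  dotp y (a *: x) = a * dotp y x.
Proof. by rewrite dotpC dotpZl (dotpC x). Qed.

Lemma dotpBr (R : realType) (d : nat) (x y z : 'rV[R]_d) :
  dotp z (x - y) = dotp z x - dotp z y.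
Proof. by rewrite dotpC dotpBl !(dotpC z). Qed.

Lemma dotpNN (R : realType) (d : nat) (x y : 'rV[R]_d) :
  dotp (- x) (- y) = dotp x y.
Proof. by rewrite dotpNl dotpC dotpNl opprK dotpC. Qed.

Lemma dotpxx_ge0 (R : realType) (d : nat) (x : 'rV[R]_d) : 0 <= dotp x x.
Proof. by apply: sumr_ge0 => i _; rewrite -expr2 sqr_ge0. Qed.

Lemma enorm_ge0 (R : realType) (d : nat) (x : 'rV[R]_d) : 0 <= enorm x.
Proof. exact: sqrtr_ge0. Qed.

Lemma sqr_enorm (R : realType) (d : nat) (x : 'rV[R]_d) :
  enorm x ^+ 2 = dotp x x.
Proof. by rewrite sqr_sqrtr // dotpxx_ge0. Qed.

Lemma enorm_eq0 (R : realType) (d : nat) (x : 'rV[R]_d) :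
  enorm x = 0 -> x = 0.
Proof.
move=> x0; have /eqP := sqr_enorm x; rewrite x0 expr0n /= eq_sym => /eqP dx0.
apply/rowP => i; rewrite mxE; apply/eqP; rewrite -sqrf_eq0 expr2.
apply/eqP; apply: (psumr_eq0P _ dx0) => // j _.
by rewrite -expr2 sqr_ge0.
Qed.

Lemma enormZ (R : realType) (d : nat) (a : R) (x : 'rV[R]_d) :
  enorm (a *: x) = `|a| * enorm x.
Proof.
by rewrite /enorm dotpZl dotpZr mulrA -expr2 sqrtrM ?sqr_ge0 // sqrtr_sqr.
Qed.

Lemma enorm0 (R : realType) (d : nat) : enorm (0 : 'rV[R]_d) = 0.
Proof. by rewrite -(scale0r 0) enormZ normr0 mul0r. Qed.

Lemma enormN (R : realType) (d : nat) (x : 'rV[R]_d) : enorm (- x) = enorm x.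
Proof. by rewrite -scaleN1r enormZ normrN1 mul1r. Qed.

Lemma enormBC (R : realType) (d : nat) (x y : 'rV[R]_d) :
  enorm (x - y) = enorm (y - x).
Proof. by rewrite -opprB enormN. Qed.

(** Cauchy-Schwarz: the squared norm of [enorm y *: x - enorm x *: y] expands to 2 |x||y| (|x||y| -
    x.y), and the positive factor is divided out. *)
Lemma dotp_le (R : realType) (d : nat) (x y : 'rV[R]_d) :
  dotp x y <= enorm x * enorm y.
Proof.
have [x0|x0] := eqVneq (enorm x) 0.
  by rewrite x0 mul0r (enorm_eq0 x0) -(scale0r 0) dotpZl mul0r.
have [y0|y0] := eqVneq (enorm y) 0.
  by rewrite y0 mulr0 (enorm_eq0 y0) -(scale0r 0) dotpZr mul0r.
have xy_gt0 : 0 < enorm x * enorm y by rewrite mulr_gt0 // lt0r ?x0 ?y0 enorm_ge0.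
have := dotpxx_ge0 (enorm y *: x - enorm x *: y).
rewrite !(dotpBl, dotpBr, dotpZl, dotpZr) -!sqr_enorm (dotpC y x).
rewrite [X in 0 <= X](_ : _ = 2 * ((enorm x * enorm y) *
  (enorm x * enorm y - dotp x y))); last by ring.
by rewrite !pmulr_rge0 // subr_ge0.
Qed.

Lemma enormD_le (R : realType) (d : nat) (x y : 'rV[R]_d) :
  enorm (x + y) <= enorm x + enorm y.
Proof.
rewrite -(@ler_pXn2r _ 2) ?nnegrE ?addr_ge0 ?enorm_ge0 //.
rewrite sqr_enorm !(dotpDl, dotpDr) (dotpC y x) -!sqr_enorm sqrrD.
by have := dotp_le x y; lra.
Qed.

Lemma enormB_le (R : realType) (d : nat) (x y : 'rV[R]_d) :
  enorm (x - y) <= enorm x + enorm y.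
Proof. by rewrite -(enormN y) enormD_le. Qed.

Lemma enormB_ge (R : realType) (d : nat) (x y : 'rV[R]_d) :
  enorm x - enorm y <= enorm (x - y).
Proof. by have := enormD_le (x - y) y; rewrite subrK; lra. Qed.

Lemma norm_coord_le_enorm (R : realType) (d : nat) (x : 'rV[R]_d) (i : 'I_d) :
  `|x 0 i| <= enorm x.
Proof.
rewrite -sqrtr_sqr ler_wsqrtr // /dotp (bigD1 i) //= -expr2 lerDl.
by apply: sumr_ge0 => j _; rewrite -expr2 sqr_ge0.
Qed.

(** * Scalar profiles of the truncation *)

Definition cutoff (R : realType) (r u : R) : R :=
  if u <= r - 1 then 1 else if u < r then r - u else 0.

Definition radial (R : realType) (r u : R) : R :=
  if u <= r - 2 then 0
  else if u < r - 1 then u - r + 2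
  else if u <= r then 1
  else r / u.

(** Isolates the profiles as functions of one real variable, so that their estimates need no
    vectors. *)
Lemma truncE (R : realType) (d : nat) (g : 'rV[R]_d -> 'rV[R]_d) (M r : R)
    (x0 x : 'rV[R]_d) :
  trunc g M r x0 x = cutoff r (enorm (x - x0)) *: g x
    + (M * radial r (enorm (x - x0))) *: (x - x0).
Proof. by []. Qed.

Lemma cutoff_ge0 (R : realType) (r u : R) : 0 <= cutoff r u.
Proof. by rewrite /cutoff; case: (leP u) => // ?; case: (ltP u) => // ?; lra. Qed.

Lemma cutoff_le1 (R : realType) (r u : R) : cutoff r u <= 1.
Proof. by rewrite /cutoff; case: (leP u) => // ?; case: (ltP u) => // ?; lra. Qed.

Lemma cutoff_eq0 (R : realType) (r u : R) : r <= u -> cutoff r u = 0.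
Proof.
by rewrite /cutoff => ru; case: (leP u) => ?; [lra|case: (ltP u) => ?; lra].
Qed.

Lemma cutoff_eq1 (R : realType) (r u : R) : u <= r - 1 -> cutoff r u = 1.
Proof. by rewrite /cutoff => ->. Qed.

Lemma cutoff_mid (R : realType) (r u : R) : r - 1 <= u -> u <= r ->
  cutoff r u = r - u.
Proof.
rewrite /cutoff => ru ur; have [?|?] := leP u (r - 1); first by lra.
by have [//|?] := ltP u r; lra.
Qed.

Lemma cutoff_nonincreasing (R : realType) (r u v : R) :
  u <= v -> cutoff r v <= cutoff r u.
Proof.
move=> uv; have [ru|/ltW ur] := leP u (r - 1).
  by rewrite (cutoff_eq1 ru) cutoff_le1.
have [vr|/ltW rv] := leP v r; last by rewrite (cutoff_eq0 rv) cutoff_ge0.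
by rewrite !cutoff_mid; lra.
Qed.

Lemma radial_eq0 (R : realType) (r u : R) : u <= r - 2 -> radial r u = 0.
Proof. by rewrite /radial => ->. Qed.

Lemma radial_mid (R : realType) (r u : R) : r - 2 <= u -> u <= r - 1 ->
  radial r u = u - r + 2.
Proof.
rewrite /radial => ru ur; have [?|?] := leP u (r - 2); first by lra.
have [//|?] := ltP u (r - 1); have [?|?] := leP u r; last by lra.
by rewrite (_ : u = r - 1); lra.
Qed.

Lemma radial_eq1 (R : realType) (r u : R) : r - 1 <= u -> u <= r ->
  radial r u = 1.
Proof.
rewrite /radial => ru ->; have [?|?] := leP u (r - 2); first by lra.
by have [?|//] := ltP u (r - 1); lra.
Qed.

Lemma radial_outside (R : realType) (r u : R) : r <= u -> 0 < r ->
  radial r u = r / u.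
Proof.
rewrite /radial => ru r0; have [?|?] := leP u (r - 2); first lra.
have [?|?] := ltP u (r - 1); first lra.
by have [?|//] := leP u r; rewrite (_ : u = r) ?divff //; lra.
Qed.

Lemma radial_ge0 (R : realType) (r u : R) : 2 <= r -> 0 <= u ->
  0 <= radial r u.
Proof.
rewrite /radial => r2 u0; case: (leP u) => // ?; case: (ltP u) => ?; first lra.
by case: (leP u) => // ?; rewrite divr_ge0 //; lra.
Qed.

Lemma radial_le1 (R : realType) (r u : R) : 2 <= r -> 0 <= u -> radial r u <= 1.
Proof.
rewrite /radial => r2 u0; case: (leP u) => // ?; case: (ltP u) => ?; first lra.
by case: (leP u) => // ?; rewrite ler_pdivrMr; lra.
Qed.

(* [radial r u * u] is the norm of [radial r (enorm z) *: z] at [u = enorm z];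
   adding [cutoff r u] to it cancels the slope of the cutoff. *)
Lemma cutoff_add_radial (R : realType) (r u : R) : 2 <= r -> 0 <= u ->
  cutoff r u + radial r u * u =
    if u <= r - 2 then 1 else if u <= r - 1 then 1 + u * (u - r + 2) else r.
Proof.
move=> r2 u0; have [u2|/ltW u2] := leP u (r - 2).
  by rewrite cutoff_eq1 ?radial_eq0 //; lra.
have [u1|/ltW u1] := leP u (r - 1).
  by rewrite cutoff_eq1 ?radial_mid // mulrC.
have [ur|/ltW ru] := leP u r; first by rewrite cutoff_mid ?radial_eq1 //; lra.
by rewrite cutoff_eq0 ?radial_outside ?divfK //; lra.
Qed.

(** For [x] and [y] on a common ray the pairing of the radial terms is [v - u] times this right-hand
    side, which settles the collinear case of [dotp_radial_ge]. *)
Lemma cutoff_add_radial_nondecreasing (R : realType) (r u v : R) :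
  2 <= r -> 0 <= u -> u <= v ->
  cutoff r u - cutoff r v <= radial r v * v - radial r u * u.
Proof.
move=> r2 u0 uv; have v0 : 0 <= v by exact: le_trans uv.
suff : cutoff r u + radial r u * u <= cutoff r v + radial r v * v by lra.
rewrite !cutoff_add_radial //.
have [u2|u2] := leP u (r - 2).
  have [//|v2] := leP v (r - 2); have [v1|v1] := leP v (r - 1); last by lra.
  by rewrite lerDl mulr_ge0 //; lra.
have [v2|v2] := leP v (r - 2); first by lra.
have [u1|u1] := leP u (r - 1); have [v1|v1] := leP v (r - 1); try by lra.
  by rewrite lerD2l ler_pM //; lra.
have : u * (u - r + 2) <= u * 1 by rewrite ler_wpM2l //; lra.
by lra.
Qed.

(** The slope condition behind [dotp_radial_ge]. Where the cutoff descends, with slope -1,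
    [radial r v] is 1; beyond [r] the right-hand side is r - (r / v) u >= r - u. *)
Lemma cutoff_lipschitz (R : realType) (r u v : R) :
  2 <= r -> 0 <= u -> u <= v ->
  cutoff r u - cutoff r v <= radial r v * (v - u).
Proof.
move=> r2 u0 uv; have v0 : 0 <= v by exact: le_trans uv.
have [v1|/ltW v1] := leP v (r - 1).
  by rewrite !cutoff_eq1 ?subrr ?mulr_ge0 ?radial_ge0 //; lra.
have [vr|/ltW rv] := leP v r.
  rewrite radial_eq1 // (@cutoff_mid _ r v) // mul1r.
  have [u1|/ltW u1] := leP u (r - 1); first by rewrite cutoff_eq1 //; lra.
  by rewrite cutoff_mid //; lra.
rewrite (cutoff_eq0 rv) subr0.
have [ur|/ltW ru] := leP u r; last first.
  by rewrite cutoff_eq0 ?mulr_ge0 ?radial_ge0 //; lra.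
apply: (@le_trans _ _ (r - u)).
  have [u1|/ltW u1] := leP u (r - 1); first by rewrite cutoff_eq1 //; lra.
  by rewrite cutoff_mid.
rewrite mulrBr radial_outside ?divfK; [|lra..].
have : r / v * u <= 1 * u by rewrite ler_wpM2r // ler_pdivrMr; lra.
by lra.
Qed.

Lemma radial_mul_le (R : realType) (r u : R) : 2 <= r -> 0 <= u ->
  radial r u * u <= Num.min u r.
Proof.
move=> r2 u0; rewrite le_min; apply/andP; split.
  by rewrite ler_piMl // radial_le1.
have [ru|ur] := leP r u; first by rewrite radial_outside ?divfK; lra.
by apply: le_trans (ltW ur); rewrite ler_piMl // radial_le1.
Qed.

(** * Monotonicity of a truncated monotone field *)

Lemma dotp_radial_ge (R : realType) (d : nat) (r : R) (x y : 'rV[R]_d) :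
  2 <= r -> enorm x <= enorm y ->
  (cutoff r (enorm x) - cutoff r (enorm y)) * enorm (x - y)
    <= dotp (radial r (enorm x) *: x - radial r (enorm y) *: y) (x - y).
Proof.
move=> r2; have := enormB_ge y x; rewrite enormBC.
rewrite !(dotpBl, dotpBr, dotpZl) (dotpC y x) -!sqr_enorm.
have : enorm (x - y) ^+ 2 = enorm x ^+ 2 + enorm y ^+ 2 - 2 * dotp x y.
  by rewrite !sqr_enorm !(dotpBl, dotpBr) (dotpC y x); ring.
have := cutoff_add_radial_nondecreasing r2 (enorm_ge0 x) (v := enorm y).
have := cutoff_lipschitz r2 (enorm_ge0 x) (v := enorm y).
have := radial_ge0 r2 (enorm_ge0 x); have := radial_ge0 r2 (enorm_ge0 y).
have := @cutoff_nonincreasing _ r (enorm x) (enorm y).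
move: (enorm x) (enorm y) (enorm (x - y)) (dotp x y) => u v rho k.
move: (radial r u) (radial r v) => s s'.
move=> + s'0 s0 + + rhoE + uv => /(_ uv) t0 /(_ uv) lip /(_ uv) nondec rho_ge.
move: (cutoff r u - cutoff r v) lip nondec t0 => t lip nondec t0.
have kE : k = (u ^+ 2 + v ^+ 2 - rho ^+ 2) / 2 by lra.
pose del := v - u; have del_ge0 : 0 <= del by rewrite subr_ge0.
(* As a function of [rho] on [del, +oo[, the difference of both sides is
   convex, and it has nonnegative value and slope at [rho = del]. *)
have h1 : 0 <= (rho - del) * (s' * del - t) by rewrite mulr_ge0 // subr_ge0.
have h2 : 0 <= del * (s' * v - s * u - t) by rewrite mulr_ge0 // subr_ge0.
have h3 : 0 <= (s + s') * (rho - del) ^+ 2 by rewrite mulr_ge0 ?sqr_ge0 ?addr_ge0.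
have h4 : 0 <= s * del * (rho - del) by rewrite !mulr_ge0 // subr_ge0.
rewrite -subr_ge0 (_ : _ - _ = (rho - del) * (s' * del - t)
  + del * (s' * v - s * u - t) + (s + s') * (rho - del) ^+ 2 / 2
  + s * del * (rho - del)); first lra.
by rewrite kE /del; field.
Qed.

(** Write t g(x) - t' g(y) = t' (g(x) - g(y)) + (t - t') g(x). The first term is monotone; by
    Cauchy-Schwarz the second costs at most (t - t') M |x - y|, which [dotp_radial_ge] recovers from
    the radial part. *)
Lemma trunc_monotone (R : realType) (d : nat) (g : 'rV[R]_d -> 'rV[R]_d)
    (M r : R) (x0 : 'rV[R]_d) :
  2 <= r -> 0 <= M ->
  (forall x y, 0 <= dotp (g x - g y) (x - y)) ->
  (forall x, enorm (x - x0) <= r -> enorm (g x) <= M) ->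
  forall x y, 0 <= dotp (trunc g M r x0 x - trunc g M r x0 y) (x - y).
Proof.
move=> r2 M0 g_mono g_le x y.
(* Taking [x] as the point nearer to [x0] makes [t - t'] nonnegative. *)
wlog xy : x y / enorm (x - x0) <= enorm (y - x0).
  move=> H; have [|/ltW] := leP (enorm (x - x0)) (enorm (y - x0)).
    exact: H.
  by move/H; rewrite -dotpNN !opprB.
have := dotp_radial_ge r2 xy.
rewrite !truncE opprB addrA subrK.
set u := enorm (x - x0); set v := enorm (y - x0).
set t := cutoff r u; set t' := cutoff r v; set D := dotp _ _ => D_ge.
have tt' : 0 <= t - t' by rewrite subr_ge0 cutoff_nonincreasing.
have gx : (t - t') * dotp (g x) (y - x) <= (t - t') * (M * enorm (x - y)).
  (* Outside the ball, where [g] has no bound, both cutoffs vanish, since [y] is at least as far out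
     as [x]. *)
  have [ur|/ltW ru] := leP u r; last first.
    by rewrite /t /t' !cutoff_eq0 ?subrr ?mul0r // (le_trans ru).
  rewrite ler_wpM2l // (le_trans (dotp_le _ _)) // (enormBC y).
  by rewrite ler_wpM2r ?enorm_ge0 // g_le.
have gxy : 0 <= t' * dotp (g x - g y) (x - y) by rewrite mulr_ge0 ?cutoff_ge0.
have MD : 0 <= M * (D - (t - t') * enorm (x - y)).
  by rewrite mulr_ge0 // subr_ge0.
rewrite (_ : dotp _ _ = t' * dotp (g x - g y) (x - y)
  - (t - t') * dotp (g x) (y - x) + M * D).
  by lra.
have -> : dotp (g x) (y - x) = - dotp (g x) (x - y).
  by rewrite -(opprB x y) dotpC dotpNl dotpC.
by rewrite /D !(dotpBl, dotpDl, dotpZl); ring.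
Qed.

(** * Remainder of the drift and truncation radius *)

Lemma drift_rest0 (R : realType) (d : nat) (b : 'rV[R]_d -> 'rV[R]_d) (L : R) :
  drift_rest b L 0 = 0.
Proof. by rewrite /drift_rest subrr scaler0 subr0. Qed.

Lemma drift_rest_monotone (R : realType) (d : nat) (b : 'rV[R]_d -> 'rV[R]_d)
    (L : R) :
  (forall x y, dotp (b x - b y) (x - y) <= - L * enorm (x - y) ^+ 2) ->
  forall x y, 0 <= dotp (drift_rest b L x - drift_rest b L y) (x - y).
Proof.
move=> A1b x y.
have -> : drift_rest b L x - drift_rest b L y
    = - (b x - b y) - L *: (x - y).
  by apply/rowP => i; rewrite !mxE; ring.
rewrite dotpBl dotpNl dotpZl.
by have := A1b x y; rewrite sqr_enorm; lra.
Qed.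

Lemma drift_rest_growth (R : realType) (d : nat) (b : 'rV[R]_d -> 'rV[R]_d)
    (L H l : R) :
  (forall x y, enorm (drift_rest b L x - drift_rest b L y)
      <= H * (1 + enorm x + enorm y) `^ l * enorm (x - y)) ->
  forall x, enorm (drift_rest b L x) <= H * (1 + enorm x) `^ l * enorm x.
Proof.
by move=> A3 x; have := A3 x 0; rewrite drift_rest0 !subr0 enorm0 addr0.
Qed.

Lemma le_growth (R : realType) (d : nat) (g : 'rV[R]_d -> 'rV[R]_d)
    (H l r : R) : 0 <= H -> 0 <= l ->
  (forall x, enorm (g x) <= H * (1 + enorm x) `^ l * enorm x) ->
  forall x, enorm x <= r -> enorm (g x) <= H * (1 + r) `^ l * r.
Proof.
move=> H0 l0 g_le x xr; apply: (le_trans (g_le x)).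
have x0 := enorm_ge0 x.
apply: ler_pM => //; first by rewrite mulr_ge0 ?powR_ge0.
by rewrite ler_wpM2l // ge0_ler_powR ?nnegrE ?lerD2l //; lra.
Qed.

Lemma trunc_driftE (R : realType) (d : nat) (b : 'rV[R]_d -> 'rV[R]_d)
    (L H l : R) (n : nat) (x : 'rV[R]_d) :
  b x - trunc_drift b L H l n x =
  trunc (drift_rest b L) (n%:R `^ (2^-1)) (trunc_radius H l n) 0 x
    - drift_rest b L x.
Proof.
by rewrite /trunc_drift /drift_rest; move: (trunc _ _ _ _ _) => T;
  apply/rowP => i; rewrite !mxE; ring.
Qed.

Lemma add1_trunc_radius (R : realType) (H l : R) (n : nat) :
  1 + trunc_radius H l n = H `^ (- (l + 1)^-1) * n%:R `^ ((2 * (l + 1))^-1).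
Proof. by rewrite /trunc_radius; lra. Qed.

Lemma add1_trunc_radius_ge0 (R : realType) (H l : R) (n : nat) :
  0 <= 1 + trunc_radius H l n.
Proof. by rewrite add1_trunc_radius mulr_ge0 ?powR_ge0. Qed.

(** The identity for which the radius r is chosen: it makes n^(1/2) at least H (1 + r)^l r, the
    bound of [le_growth] on the ball of radius r. *)
Lemma powR_trunc_radius (R : realType) (H l : R) (n : nat) :
  0 < H -> 0 < l ->
  H * (1 + trunc_radius H l n) `^ (l + 1) = n%:R `^ (2^-1).
Proof.
move=> H0 l0; rewrite add1_trunc_radius powRM ?powR_ge0 // -!powRrM.
rewrite (_ : - _ * _ = -1); last by field; lra.
rewrite (_ : (2 * (l + 1))^-1 * _ = 2^-1); last by field; lra.
by rewrite powR_inv1 ?ltW // mulrA divff ?mul1r // gt_eqF.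
Qed.

Lemma trunc_radius_homo (R : realType) (H l : R) (m n : nat) : 0 < l ->
  (m <= n)%N -> trunc_radius H l m <= trunc_radius H l n.
Proof.
move=> l0 mn; rewrite lerD2r ler_wpM2l ?powR_ge0 //.
by rewrite ge0_ler_powR ?nnegrE ?ler_nat // invr_ge0; lra.
Qed.

Lemma trunc_radius_unbounded (R : realType) (H l K : R) : 0 < H -> 0 < l ->
  exists m : nat, forall n, (m <= n)%N -> K <= trunc_radius H l n.
Proof.
move=> H0 l0; pose e := 2 * (l + 1); pose a := H `^ (- (l + 1)^-1).
have a0 : 0 < a by rewrite powR_gt0.
have e0 : e != 0 by rewrite /e; lra.
(* Solving a n^(1/e) - 1 >= K for n leads to n >= y^e; the absolute value keeps the base
   nonnegative. *)
pose y := `|(K + 1) / a|.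
exists (Num.bound (y `^ e)) => n mn.
rewrite lerBrDr -/a -/e mulrC -ler_pdivrMr //.
apply: le_trans (ler_norm _) _; rewrite -/y.
have -> : y = (y `^ e) `^ e^-1 by rewrite -powRrM divff // powRr1 // normr_ge0.
rewrite ge0_ler_powR ?nnegrE ?powR_ge0 //; first by rewrite invr_ge0 /e; lra.
apply: (@le_trans _ _ (Num.bound (y `^ e))%:R); last by rewrite ler_nat.
by rewrite ltW // archi_boundP // powR_ge0.
Qed.

(** * Monotonicity and growth of the truncated drift *)

Lemma trunc_drift_monotone (R : realType) (d : nat)
    (b : 'rV[R]_d -> 'rV[R]_d) (L H l : R) (n : nat) :
  0 < H -> 0 < l -> 2 <= trunc_radius H l n ->
  (forall x y, dotp (b x - b y) (x - y) <= - L * enorm (x - y) ^+ 2) ->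
  (forall x, enorm (drift_rest b L x) <= H * (1 + enorm x) `^ l * enorm x) ->
  forall x y, dotp (trunc_drift b L H l n x - trunc_drift b L H l n y) (x - y)
    <= - L * enorm (x - y) ^+ 2.
Proof.
move=> H0 l0 r2 A1b g_le x y.
have g_ball z : enorm (z - 0) <= trunc_radius H l n ->
    enorm (drift_rest b L z) <= n%:R `^ (2^-1).
  rewrite subr0 => /(le_growth (ltW H0) (ltW l0) g_le) /le_trans; apply.
  rewrite -(powR_trunc_radius n H0 l0) powRD ?powRr1; last 2 first.
  - exact: add1_trunc_radius_ge0.
  - by rewrite (_ : 1 + _ != 0) ?implybT //; lra.
  by rewrite mulrA ler_wpM2l ?mulr_ge0 ?powR_ge0 ?ltW //; lra.
have := trunc_monotone r2 (powR_ge0 _ _) (drift_rest_monotone A1b) g_ball x y.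
rewrite /trunc_drift; move: (trunc _ _ _ _ x) (trunc _ _ _ _ y) => T T' TT'.
have -> : b 0 - L *: x - T - (b 0 - L *: y - T') = - (T - T') - L *: (x - y).
  by apply/rowP => i; rewrite !mxE; ring.
by rewrite dotpBl dotpNl dotpZl -sqr_enorm; lra.
Qed.

(** In the splitting n^(1/2) = H (1 + r)^l r + H (1 + r)^l the first part pays for the cut remainder
    and the second for b(0); the radial part yields the minimum. *)
Lemma enorm_trunc_drift_le (R : realType) (d : nat)
    (b : 'rV[R]_d -> 'rV[R]_d) (L H l : R) (n : nat) :
  0 < L -> 0 < H -> 0 < l -> 2 <= trunc_radius H l n ->
  enorm (b 0) <= H * (1 + trunc_radius H l n) `^ l ->
  (forall x, enorm (drift_rest b L x) <= H * (1 + enorm x) `^ l * enorm x) ->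
  forall x, enorm (trunc_drift b L H l n x) <= L * enorm x
    + n%:R `^ (2^-1) * (1 + Num.min (enorm x) (trunc_radius H l n)).
Proof.
move=> L0 H0 l0 r2 b0 g_le x; set r := trunc_radius H l n in r2 b0 *.
set M := n%:R `^ _; have M0 : 0 <= M by exact: powR_ge0.
have ME : M = H * (1 + r) `^ l * (1 + r).
  rewrite -mulrA -[X in _ * (_ * X)]powRr1 ?add1_trunc_radius_ge0 // -powRD.
    by rewrite powR_trunc_radius.
  by rewrite (_ : 1 + r != 0) ?implybT //; lra.
have tg : cutoff r (enorm x) * enorm (drift_rest b L x) <= H * (1 + r) `^ l * r.
  have [xr|/ltW rx] := leP (enorm x) r; last first.
    by rewrite cutoff_eq0 // mul0r !mulr_ge0 ?powR_ge0; lra.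
  apply: le_trans (le_growth (ltW H0) (ltW l0) g_le xr).
  by rewrite ler_piMl ?enorm_ge0 ?cutoff_le1.
have Ms : M * (radial r (enorm x) * enorm x) <= M * Num.min (enorm x) r.
  by rewrite ler_wpM2l // radial_mul_le // enorm_ge0.
have -> : trunc_drift b L H l n x = b 0 - L *: x
    - (cutoff r (enorm x) *: drift_rest b L x + (M * radial r (enorm x)) *: x).
  by rewrite /trunc_drift truncE !subr0.
apply: (le_trans (enormB_le _ _)).
have := enormB_le (b 0) (L *: x); have := enormD_le
  (cutoff r (enorm x) *: drift_rest b L x) ((M * radial r (enorm x)) *: x).
rewrite !enormZ (ger0_norm (cutoff_ge0 _ _)) (gtr0_norm L0) ger0_norm; last first.
  by rewrite mulr_ge0 // radial_ge0 // enorm_ge0.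
by lra.
Qed.

(** * Continuity and measurability *)

Lemma continuous_dotp (R : realType) (d : nat) (f h : 'rV[R]_d -> 'rV[R]_d) :
  (forall i, continuous (fun x => f x 0 i)) ->
  (forall i, continuous (fun x => h x 0 i)) ->
  continuous (fun x => dotp (f x) (h x)).
Proof.
move=> fc hc x.
apply: (@cvg_big _ _ _ _ _ add_continuous _ _ _ _ _ (nbhs_filter x)) => i _.
exact: (continuousM (@fc i x) (@hc i x)).
Qed.

Lemma continuous_enorm (R : realType) (d : nat) (f : 'rV[R]_d -> 'rV[R]_d) :
  (forall i, continuous (fun x => f x 0 i)) -> continuous (fun x => enorm (f x)).
Proof.
move=> fc x.
have dc : {for x, continuous (fun y => dotp (f y) (f y))}.
  exact: (continuous_dotp fc fc).
exact: (continuous_comp dc (@sqrt_continuous R _)).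
Qed.

(** Source of the measurability of the remainder: the growth condition makes [g] Lipschitz at each
    point. Coordinates are used because [dotp] is a polynomial in them. *)
Lemma continuous_coord_growth (R : realType) (d : nat)
    (g : 'rV[R]_d -> 'rV[R]_d) (H l : R) : 0 <= H -> 0 <= l ->
  (forall x y, enorm (g x - g y)
    <= H * (1 + enorm x + enorm y) `^ l * enorm (x - y)) ->
  forall i, continuous (fun x => g x 0 i).
Proof.
move=> H0 l0 g_lip i x.
have x_filter : Filter (nbhs x) := nbhs_filter x.
apply/cvgrPdist_le => e e0.
(* Lipschitz constant at [x] over the unit ball around it; the divisor [K + 1] below avoids a zero
   denominator. *)
pose K := H * (1 + enorm x + (enorm x + 1)) `^ l.
have K0 : 0 <= K by rewrite mulr_ge0 ?powR_ge0.
have eK0 : 0 < e / (K + 1) by rewrite divr_gt0 // ltr_wpDl.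
have cvg0 : enorm (y - x) @[y --> x] --> 0.
  rewrite -[X in _ --> X](@enorm0 R d) -(subrr x).
  apply: (@continuous_enorm R d (fun y => y - x)) => j z.
  have -> : (fun y : 'rV[R]_d => (y - x) 0 j) = (fun y => y 0 j - x 0 j).
    by apply/funext => y; rewrite !mxE.
  by apply: continuousB; [exact: coord_continuous|exact: cst_continuous].
near=> y.
have y1 : enorm (y - x) < 1 by near: y; exact: cvgr_lt cvg0 _ ltr01.
have ye : enorm (y - x) < e / (K + 1) by near: y; exact: cvgr_lt cvg0 _ eK0.
have -> : g x 0 i - g y 0 i = (g x - g y) 0 i by rewrite !mxE.
apply: (le_trans (norm_coord_le_enorm _ _)).
apply: (le_trans (g_lip _ _)); rewrite (enormBC x).
apply: (@le_trans _ _ (K * enorm (y - x))).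
  rewrite ler_wpM2r ?enorm_ge0 // ler_wpM2l // ge0_ler_powR ?nnegrE //;
    have := enorm_ge0 x; have := enorm_ge0 y; have := enormB_ge y x; lra.
move: ye; rewrite ltr_pdivlMr; last by rewrite ltr_wpDl.
by have := enorm_ge0 (y - x); lra.
Unshelve. all: by end_near. Qed.

Lemma measurable_continuous_RV (R : realType) (d : nat)
    (disp : measure_display) (Omega : measurableType disp)
    (P : probability Omega R) (X : {RV P >-> borel_rV R d})
    (f : 'rV[R]_d -> R) :
  continuous f -> measurable_fun setT (fun w => f (X w)).
Proof.
move=> fc; apply: (@measurableT_comp _ _ _ _ _ _ (f : borel_rV R d -> R)) => //.
(* Open rays generate the Borel sets of the line, and their preimages under [f] are open. *)
apply: (measurability _ (RGenOInfty.measurableE R)) => // _ [_ [a ->] <-].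
rewrite setTI; apply: sub_sigma_algebra.
by apply: open_comp => //= *; exact: fc.
Qed.

(** * Pointwise bounds for the truncation error *)

Definition drift_error (R : realType) (d : nat) (b : 'rV[R]_d -> 'rV[R]_d)
    (L H l : R) (n : nat) (x : 'rV[R]_d) : R :=
  enorm (b x - trunc_drift b L H l n x).

(** Serves measurability: the square is a polynomial in the two profiles, |x|, |g(x)| and g(x).x,
    each of which is measurable along a random vector. *)
Lemma sqr_drift_error (R : realType) (d : nat) (b : 'rV[R]_d -> 'rV[R]_d)
    (L H l : R) (n : nat) (x : 'rV[R]_d) :
  let g := drift_rest b L in
  let t := cutoff (trunc_radius H l n) (enorm x) - 1 in
  let s := n%:R `^ (2^-1) * radial (trunc_radius H l n) (enorm x) in
  drift_error b L H l n x ^+ 2 =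
    t ^+ 2 * enorm (g x) ^+ 2 + 2 * (t * s) * dotp (g x) x + s ^+ 2 * enorm x ^+ 2.
Proof.
rewrite /drift_error trunc_driftE truncE subr0 /=.
set t := cutoff _ _; set s := _ * radial _ _; move: (drift_rest b L x) => g.
have -> : t *: g + s *: x - g = (t - 1) *: g + s *: x.
  by apply/rowP => i; rewrite !mxE; ring.
rewrite !sqr_enorm !(dotpDl, dotpDr, dotpZl, dotpZr) (dotpC x g).
by ring.
Qed.

Lemma drift_error_eq0 (R : realType) (d : nat) (b : 'rV[R]_d -> 'rV[R]_d)
    (L H l : R) (n : nat) (x : 'rV[R]_d) :
  enorm x <= trunc_radius H l n - 2 -> drift_error b L H l n x = 0.
Proof.
move=> xr; rewrite /drift_error trunc_driftE truncE subr0 radial_eq0 //.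
by rewrite cutoff_eq1 ?mulr0 ?scale0r ?scale1r ?addr0 ?subrr ?enorm0 //; lra.
Qed.

Lemma drift_error_le (R : realType) (d : nat) (b : 'rV[R]_d -> 'rV[R]_d)
    (L H l : R) (n : nat) (x : 'rV[R]_d) :
  2 <= trunc_radius H l n ->
  drift_error b L H l n x
    <= enorm (drift_rest b L x) + n%:R `^ (2^-1) * trunc_radius H l n.
Proof.
move=> r2; rewrite /drift_error trunc_driftE truncE subr0.
set r := trunc_radius H l n in r2 *; move: (drift_rest b L x) => g.
rewrite addrAC (le_trans (enormD_le _ _)) // lerD //.
  have -> : cutoff r (enorm x) *: g - g = (cutoff r (enorm x) - 1) *: g.
    by rewrite scalerBl scale1r.
  rewrite enormZ ler_piMl ?enorm_ge0 // ler0_norm; last first.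
    by have := cutoff_le1 r (enorm x); lra.
  by have := cutoff_ge0 r (enorm x); lra.
have x0 := enorm_ge0 x.
rewrite enormZ normrM (ger0_norm (powR_ge0 _ _)) ger0_norm ?radial_ge0 //.
rewrite -mulrA ler_wpM2l ?powR_ge0 // (le_trans (radial_mul_le r2 x0)) //.
by rewrite ge_min lexx orbT.
Qed.

(** A converse to [drift_error_le], through which the error at one index controls the error at
    another. Inside the ball the growth bound suffices; outside it the cutoff is 0, so the remainder
    is the radial term minus b(x) - b_n(x). *)
Lemma drift_rest_le_error (R : realType) (d : nat) (b : 'rV[R]_d -> 'rV[R]_d)
    (L H l : R) (n : nat) (x : 'rV[R]_d) :
  0 < H -> 0 < l -> 2 <= trunc_radius H l n ->
  (forall x, enorm (drift_rest b L x) <= H * (1 + enorm x) `^ l * enorm x) ->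
  enorm (drift_rest b L x)
    <= drift_error b L H l n x + n%:R `^ (2^-1) * trunc_radius H l n.
Proof.
move=> H0 l0 r2 g_le; have x0 := enorm_ge0 x.
set r := trunc_radius H l n in r2 *; set M := n%:R `^ _.
have M0 : 0 <= M by exact: powR_ge0.
have [xr|/ltW rx] := leP (enorm x) r.
  apply: ler_wpDl; first exact: enorm_ge0.
  apply: (le_trans (le_growth (ltW H0) (ltW l0) g_le xr)).
  rewrite ler_wpM2r //; first lra.
  rewrite /M -(powR_trunc_radius n H0 l0) -/r.
  by rewrite ler_wpM2l ?(ltW H0) // ler_powR //; lra.
have -> : drift_rest b L x = (M * radial r (enorm x)) *: x
    - (b x - trunc_drift b L H l n x).
  rewrite trunc_driftE truncE subr0 cutoff_eq0 // scale0r add0r.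
  by rewrite opprB addrC subrK.
apply: (le_trans (enormB_le _ _)); rewrite addrC lerD2l enormZ.
rewrite ger0_norm ?mulr_ge0 ?radial_ge0 // -mulrA ler_wpM2l //.
by rewrite radial_outside ?divfK; lra.
Qed.

(** The sum is at most twice its larger term; this treats exponents below and above 1 alike. *)
Lemma le_powRD (R : realType) (a c p : R) : 0 <= a -> 0 <= c -> 0 <= p ->
  (a + c) `^ p <= (2 * a) `^ p + (2 * c) `^ p.
Proof.
move=> a0 c0 p0; have [ac|/ltW ca] := leP a c.
  apply: ler_wpDl; first exact: powR_ge0.
  by apply: ge0_ler_powR; rewrite ?nnegrE //; lra.
apply: ler_wpDr; first exact: powR_ge0.
by apply: ge0_ler_powR; rewrite ?nnegrE //; lra.
Qed.

(* Outside the ball of radius [r - 2] the ratio [4 * u / (1 + r)] is at least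
   [1], so that Markov's trade of powers of the radius for moments applies. *)
Lemma tail_weight (R : realType) (r u k q s : R) : 3 <= r -> r - 2 < u ->
  k <= q ->
  (1 + r) `^ s * (4 * u / (1 + r)) `^ k <= 4 `^ q * (1 + r) `^ (s - q) * u `^ q.
Proof.
move=> r3 ru kq; apply: (@le_trans _ _ ((1 + r) `^ s * (4 * u / (1 + r)) `^ q)).
  rewrite ler_wpM2l ?powR_ge0 // ler_powR // ler_pdivlMr; lra.
have r0 : 1 + r != 0 by lra.
rewrite !powRM ?invr_ge0; [|lra..].
rewrite -powR_inv1; last lra.
rewrite -powRrM mulN1r -(mulrA (4 `^ q)) mulrA (mulrC _ (4 `^ q)).
have -> : (1 + r) `^ (s - q) = (1 + r) `^ s * (1 + r) `^ (- q).
  by rewrite powRD // r0 implybT.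
by rewrite !mulrA -!(mulrA (_ * _)) (mulrC (u `^ q)).
Qed.

Lemma sqrt_mul_trunc_radius_le (R : realType) (H l : R) (n : nat) :
  0 < H -> 0 < l -> 0 <= trunc_radius H l n ->
  n%:R `^ (2^-1) * trunc_radius H l n <= H * (1 + trunc_radius H l n) `^ (l + 2).
Proof.
move=> H0 l0 r0; set r := trunc_radius H l n in r0 *.
rewrite (_ : l + 2 = (l + 1) + 1); last by ring.
rewrite powRD; last by rewrite (_ : 1 + r != 0) ?implybT //; lra.
rewrite powRr1 ?add1_trunc_radius_ge0 // mulrA powR_trunc_radius //.
by rewrite ler_wpM2l ?powR_ge0 // lerDr.
Qed.

Lemma drift_error_powR_le (R : realType) (d : nat) (b : 'rV[R]_d -> 'rV[R]_d)
    (L H l p p0 : R) (n : nat) (x : 'rV[R]_d) :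
  0 < H -> 0 < l -> 0 < p -> (l + 1) * p <= p0 -> 3 <= trunc_radius H l n ->
  (forall x, enorm (drift_rest b L x) <= H * (1 + enorm x) `^ l * enorm x) ->
  drift_error b L H l n x `^ p <=
    (2 * H) `^ p * (4 `^ p0 * (1 + trunc_radius H l n) `^ ((l + 2) * p - p0)
                    * enorm x `^ p0).
Proof.
move=> H0 l0 p_gt0 lp r3 g_le; set r := trunc_radius H l n in r3 *.
have [xr|rx] := leP (enorm x) (r - 2).
  by rewrite drift_error_eq0 // powR0 ?gt_eqF // !mulr_ge0 ?powR_ge0.
have r0 : 1 + r != 0 by lra.
set q := 4 * enorm x / (1 + r).
(* Here the bound 3 on the radius enters: 4 (r - 2) >= 1 + r exactly when r >= 3. *)
have q1 : 1 <= q by rewrite ler_pdivlMr; lra.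
have rq : 4 * enorm x = (1 + r) * q by rewrite /q [RHS]mulrC divfK.
have gx : enorm (drift_rest b L x) <= H * (1 + r) `^ (l + 2) * q `^ (l + 1).
  apply: (le_trans (g_le x)); rewrite -!mulrA ler_wpM2l ?(ltW H0) //.
  (* Both |x| and 1 + |x| are at most 4 |x|, because |x| > r - 2 >= 1. *)
  apply: (@le_trans _ _ ((4 * enorm x) `^ (l + 1))).
    rewrite powRD; last by rewrite (_ : 4 * enorm x != 0) ?implybT //; lra.
    rewrite powRr1; last lra.
    apply: ler_pM; rewrite ?powR_ge0 ?enorm_ge0 //; last lra.
    by apply: ge0_ler_powR; rewrite ?nnegrE ?(ltW l0) //; lra.
  rewrite rq powRM; [|lra..].
  by rewrite ler_wpM2r ?powR_ge0 // ler_powR //; lra.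
have Mr : n%:R `^ (2^-1) * r <= H * (1 + r) `^ (l + 2) * q `^ (l + 1).
  apply: (le_trans (sqrt_mul_trunc_radius_le H0 l0 _)); first by rewrite -/r; lra.
  rewrite ler_peMr ?mulr_ge0 ?powR_ge0 ?(ltW H0) //.
  by rewrite -[leLHS](powRr0 q) ler_powR //; lra.
apply: (@le_trans _ _ ((2 * H * (1 + r) `^ (l + 2) * q `^ (l + 1)) `^ p)).
  apply: ge0_ler_powR; rewrite ?nnegrE ?enorm_ge0 ?(ltW p_gt0) //.
    by rewrite !mulr_ge0 ?powR_ge0 //; lra.
  have r2 : 2 <= trunc_radius H l n by rewrite -/r; lra.
  by have := @drift_error_le R d b L H l n x r2; rewrite -/r; lra.
(* The error carries [q] to the power [(l + 1) * p], which [lp] allows to be raised to [p0]. *)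
have := @tail_weight _ _ _ _ _ ((l + 2) * p) r3 rx lp; rewrite -/q.
have q0 : 0 <= q by lra.
have H20 : 0 <= 2 * H by rewrite mulr_ge0 // ltW.
clearbody q => tail; rewrite -(mulrA (2 * H)) powRM ?H20 ?mulr_ge0 ?powR_ge0 //.
by rewrite ler_wpM2l ?powR_ge0 // powRM ?powR_ge0 // -!powRrM.
Qed.

(** The remainder links the two errors: [drift_error_le] at [n] is followed by [drift_rest_le_error]
    at [m]. Each costs a square root times a radius, the cost at [m] being no larger, so together
    they give 2 H (1 + r)^(l+2). *)
Lemma drift_error_powR_le_error (R : realType) (d : nat)
    (b : 'rV[R]_d -> 'rV[R]_d) (L H l p p0 : R) (m n : nat) (x : 'rV[R]_d) :
  0 < H -> 0 < l -> 0 < p -> 0 < p0 -> 3 <= trunc_radius H l m -> (m <= n)%N ->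
  (forall x, enorm (drift_rest b L x) <= H * (1 + enorm x) `^ l * enorm x) ->
  drift_error b L H l n x `^ p <=
    2 `^ p * drift_error b L H l m x `^ p
    + (4 * H) `^ p * (4 `^ p0 * (1 + trunc_radius H l n) `^ ((l + 2) * p - p0)
                      * enorm x `^ p0).
Proof.
move=> H0 l0 p_gt0 p0_gt0 r3 mn g_le; have rmn := trunc_radius_homo H l0 mn.
set r := trunc_radius H l n in rmn *; set rm := trunc_radius H l m in r3 rmn.
have [xr|rx] := leP (enorm x) (r - 2).
  rewrite drift_error_eq0 // powR0 ?gt_eqF // addr_ge0 //.
    by rewrite mulr_ge0 ?powR_ge0.
  by rewrite !mulr_ge0 ?powR_ge0.
have Mr : n%:R `^ (2^-1) * r <= H * (1 + r) `^ (l + 2).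
  by apply: sqrt_mul_trunc_radius_le => //; rewrite -/r; lra.
have Mrm : m%:R `^ (2^-1) * rm <= n%:R `^ (2^-1) * r.
  apply: ler_pM; rewrite ?powR_ge0 //; first lra.
  by rewrite ge0_ler_powR ?nnegrE ?ler_nat.
have err_le : drift_error b L H l n x
    <= drift_error b L H l m x + 2 * H * (1 + r) `^ (l + 2).
  have r2 : 2 <= trunc_radius H l n by rewrite -/r; lra.
  have rm2 : 2 <= trunc_radius H l m by rewrite -/rm; lra.
  have := @drift_error_le R d b L H l n x r2.
  have := @drift_rest_le_error R d b L H l m x H0 l0 rm2 g_le.
  rewrite -/r -/rm; move: (drift_error b L H l m x) (drift_error b L H l n x).
  move: (enorm _) Mr Mrm; move: (_ * r) (_ * rm) (_ `^ (l + 2)) => A B C.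
  by move=> *; lra.
have H20 : 0 <= 2 * H * (1 + r) `^ (l + 2).
  by rewrite !mulr_ge0 ?powR_ge0 ?(ltW H0).
have em0 : 0 <= drift_error b L H l m x by exact: enorm_ge0.
apply: (@le_trans _ _ ((drift_error b L H l m x
    + 2 * H * (1 + r) `^ (l + 2)) `^ p)).
  by apply: ge0_ler_powR; rewrite ?nnegrE ?enorm_ge0 ?addr_ge0 ?(ltW p_gt0).
(* The doubling under the power produces the factor 2^p and turns [2 * H] into [4 * H]. *)
apply: (le_trans (le_powRD em0 H20 (ltW p_gt0))).
rewrite powRM // lerD2l !mulrA (_ : 2 * 2 = 4); last by ring.
rewrite powRM ?powR_ge0 ?mulr_ge0 ?(ltW H0) // -powRrM -!mulrA.
rewrite ler_wpM2l ?powR_ge0 // mulrA.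
have r3' : 3 <= r by exact: le_trans r3 rmn.
(* With exponent 0 the ratio contributes 1, so a power of the radius alone is traded for |x|^p0. *)
have := @tail_weight _ _ _ 0 p0 ((l + 2) * p) r3' rx (ltW p0_gt0).
by rewrite powRr0 mulr1.
Qed.

(** * Measurability of the error *)

Lemma measurable_cutoff (R : realType) (r : R) : measurable_fun setT (cutoff r).
Proof.
apply: measurable_fun_ifT => //; first exact: measurable_fun_ler.
apply: measurable_fun_ifT => //; first exact: measurable_fun_ltr.
exact: measurable_funB.
Qed.

Lemma measurable_radial (R : realType) (r : R) : 0 <= r ->
  measurable_fun setT (radial r).
Proof.
move=> r0.
(* Division is recast as a real power, which is measurable in [u]; the two agree on that branch,
   where u > r >= 0. *)
have -> : radial r = fun u => if u <= r - 2 then 0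
    else if u < r - 1 then u - r + 2
    else if u <= r then 1 else r * u `^ (-1).
  apply/funext => u; rewrite /radial; case: (leP u r) => // ru.
  by rewrite powR_inv1 // ltW // (le_lt_trans r0).
apply: measurable_fun_ifT => //; first exact: measurable_fun_ler.
apply: measurable_fun_ifT => //; first exact: measurable_fun_ltr.
  by apply: measurable_funD => //; exact: measurable_funB.
apply: measurable_fun_ifT => //; first exact: measurable_fun_ler.
by apply: measurable_funM => //; exact: measurable_powR.
Qed.

Lemma measurable_enorm_powR (R : realType) (d : nat)
    (disp : measure_display) (Omega : measurableType disp)
    (P : probability Omega R) (X : {RV P >-> borel_rV R d}) (p : R) :
  measurable_fun setT (fun w => (enorm (X w) `^ p)%:E).
Proof.
apply/measurable_EFinP.
apply: (measurableT_comp (measurable_powR p)).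
apply: measurable_continuous_RV; apply: continuous_enorm => i.
exact: coord_continuous.
Qed.

Lemma measurable_drift_error_powR (R : realType) (d : nat)
    (disp : measure_display) (Omega : measurableType disp)
    (P : probability Omega R) (X : {RV P >-> borel_rV R d})
    (b : 'rV[R]_d -> 'rV[R]_d) (L H l p : R) (n : nat) :
  0 <= H -> 0 <= l -> 0 <= trunc_radius H l n ->
  (forall x y, enorm (drift_rest b L x - drift_rest b L y)
      <= H * (1 + enorm x + enorm y) `^ l * enorm (x - y)) ->
  measurable_fun setT (fun w => (drift_error b L H l n (X w) `^ p)%:E).
Proof.
move=> H0 l0 r0 A3; apply/measurable_EFinP.
(* The exponent is halved so that the polynomial formula for the squared error applies. *)
have -> : (fun w => drift_error b L H l n (X w) `^ p)
    = (fun w => (drift_error b L H l n (X w) ^+ 2) `^ (p / 2)).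
  apply/funext => w; rewrite -powR_mulrn ?enorm_ge0 // -powRrM.
  by congr (_ `^ _); field.
apply: (measurableT_comp (measurable_powR _)).
under eq_fun do rewrite sqr_drift_error.
have gc := continuous_coord_growth H0 l0 A3.
have idc (i : 'I_d) : continuous (fun x : 'rV[R]_d => x 0 i).
  exact: coord_continuous.
have mx := measurable_continuous_RV X (continuous_enorm idc).
have mg := measurable_continuous_RV X (continuous_enorm gc).
have mgx := measurable_continuous_RV X (continuous_dotp gc idc).
have mt := measurableT_comp (measurable_cutoff (trunc_radius H l n)) mx.
have ms := measurableT_comp (measurable_radial r0) mx.
have mt1 := measurable_funB mt (measurable_cst (1 : R)).
have mMs := measurable_funM (measurable_cst (n%:R `^ (2^-1) : R)) ms.
apply: measurable_funD; first apply: measurable_funD.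
- by apply: measurable_funM; exact: measurable_funX.
- apply: measurable_funM => //; apply: measurable_funM => //.
  exact: measurable_funM.
- by apply: measurable_funM; exact: measurable_funX.
Qed.

(** * Moments of the error *)

Lemma ge0_integral_le_lincomb (R : realType) (disp : measure_display)
    (T : measurableType disp) (mu : {measure set T -> \bar R})
    (f g h : T -> R) (a k : R) :
  0 <= a -> 0 <= k ->
  (forall w, 0 <= f w) -> (forall w, 0 <= g w) -> (forall w, 0 <= h w) ->
  measurable_fun setT (fun w => (f w)%:E) ->
  measurable_fun setT (fun w => (g w)%:E) ->
  measurable_fun setT (fun w => (h w)%:E) ->
  (forall w, f w <= a * g w + k * h w) ->
  (\int[mu]_w (f w)%:E
     <= a%:E * \int[mu]_w (g w)%:E + k%:E * \int[mu]_w (h w)%:E)%E.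
Proof.
move=> a0 k0 f0 g0 h0 mf mg mh fgh.
have g0E w : [set: T] w -> (0 <= (g w)%:E)%E by rewrite lee_fin.
have h0E w : [set: T] w -> (0 <= (h w)%:E)%E by rewrite lee_fin.
rewrite -(ge0_integralZl_EFin mu measurableT g0E mg a0).
rewrite -(ge0_integralZl_EFin mu measurableT h0E mh k0).
rewrite -ge0_integralD //; first last.
- exact: measurable_funeM.
- by move=> w _; rewrite -EFinM lee_fin mulr_ge0.
- exact: measurable_funeM.
- by move=> w _; rewrite -EFinM lee_fin mulr_ge0.
apply: ge0_le_integral => //.
- by move=> w _; rewrite lee_fin.
- by apply: emeasurable_funD; exact: measurable_funeM.
- by move=> w _; rewrite -!EFinM -EFinD lee_fin.
Qed.

Lemma abs_momentE (R : realType) (d : nat) (disp : measure_display)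
    (Omega : measurableType disp) (P : probability Omega R) (p : R)
    (Y : Omega -> 'rV[R]_d) :
  abs_moment P p Y = (\int[P]_w (enorm (Y w) `^ p)%:E)%E.
Proof. by rewrite /abs_moment unlock. Qed.

Lemma abs_moment_ge0 (R : realType) (d : nat) (disp : measure_display)
    (Omega : measurableType disp) (P : probability Omega R) (p : R)
    (Y : Omega -> 'rV[R]_d) : (0 <= abs_moment P p Y)%E.
Proof.
by rewrite abs_momentE integral_ge0 // => w _; rewrite lee_fin powR_ge0.
Qed.

(** Turns powers of the radius into the final rate in [n]; the factor in [H] goes into the
    constants. *)
Lemma powR_add1_trunc_radius (R : realType) (H l e : R) (n : nat) :
  (1 + trunc_radius H l n) `^ e =
  H `^ (- (l + 1)^-1 * e) * n%:R `^ (e / (2 * (l + 1))).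
Proof.
by rewrite add1_trunc_radius powRM ?powR_ge0 // -!powRrM (mulrC _^-1 e).
Qed.

Lemma trunc_radius_gt0 (R : realType) (H l : R) (n : nat) : 0 < l ->
  0 <= trunc_radius H l n -> (0 < n)%N.
Proof.
(* For n = 0 the power of zero is 0, so the radius would be -1. *)
move=> l0; case: n => //; rewrite /trunc_radius powR0.
  by rewrite mulr0 sub0r oppr_ge0 ler10.
by rewrite invr_eq0 gt_eqF // mulr_gt0 //; lra.
Qed.

Lemma drift_error_moment_le (R : realType) (d : nat) (disp : measure_display)
    (Omega : measurableType disp) (P : probability Omega R)
    (X : {RV P >-> borel_rV R d}) (b : 'rV[R]_d -> 'rV[R]_d)
    (L H l p p0 : R) (n : nat) :
  0 < H -> 0 < l -> 0 < p -> (l + 1) * p <= p0 -> 3 <= trunc_radius H l n ->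
  (forall x y, enorm (drift_rest b L x - drift_rest b L y)
      <= H * (1 + enorm x + enorm y) `^ l * enorm (x - y)) ->
  (abs_moment P p (fun w => b (X w) - trunc_drift b L H l n (X w))%R
   <= ((2 * H) `^ p * 4 `^ p0 * H `^ (- (l + 1)^-1 * ((l + 2) * p - p0))
       * n%:R `^ (((l + 2) * p - p0) / (2 * (l + 1))))%R%:E
      * abs_moment P p0 X)%E.
Proof.
move=> H0 l0 p_gt0 lp r3 A3.
have r0 : 0 <= trunc_radius H l n by lra.
rewrite !abs_momentE -ge0_integralZl_EFin //; last 3 first.
- by move=> w _; rewrite lee_fin powR_ge0.
- exact: measurable_enorm_powR.
- by rewrite !mulr_ge0 ?powR_ge0.
apply: ge0_le_integral => //.
- by move=> w _; rewrite lee_fin powR_ge0.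
- exact: (measurable_drift_error_powR X p (ltW H0) (ltW l0) r0 A3).
- apply: measurable_funeM; exact: measurable_enorm_powR.
- move=> w _; rewrite -EFinM lee_fin.
  have := @drift_error_powR_le R d b L H l p p0 n (X w) H0 l0 p_gt0 lp r3
    (drift_rest_growth A3).
  by rewrite powR_add1_trunc_radius !mulrA.
Qed.

Lemma drift_error_moment_le_error (R : realType) (d : nat)
    (disp : measure_display) (Omega : measurableType disp)
    (P : probability Omega R) (X : {RV P >-> borel_rV R d})
    (b : 'rV[R]_d -> 'rV[R]_d) (L H l p p0 : R) (m n : nat) :
  0 < H -> 0 < l -> 0 < p -> 0 < p0 -> 3 <= trunc_radius H l m -> (m <= n)%N ->
  (forall x y, enorm (drift_rest b L x - drift_rest b L y)
      <= H * (1 + enorm x + enorm y) `^ l * enorm (x - y)) ->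
  (abs_moment P p (fun w => b (X w) - trunc_drift b L H l n (X w))%R
   <= (2 `^ p)%:E
        * abs_moment P p (fun w => b (X w) - trunc_drift b L H l m (X w))%R
    + ((4 * H) `^ p * 4 `^ p0 * H `^ (- (l + 1)^-1 * ((l + 2) * p - p0))
       * n%:R `^ (((l + 2) * p - p0) / (2 * (l + 1))))%R%:E
      * abs_moment P p0 X)%E.
Proof.
move=> H0 l0 p_gt0 p0_gt0 r3 mn A3.
have rm0 : 0 <= trunc_radius H l m by lra.
have r0 := le_trans rm0 (trunc_radius_homo H l0 mn).
have err_ge0 q w : 0 <= drift_error b L H l q (X w) `^ p by exact: powR_ge0.
rewrite /abs_moment unlock; apply: ge0_integral_le_lincomb.
- exact: powR_ge0.
- by rewrite !mulr_ge0 ?powR_ge0.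
- exact: err_ge0.
- exact: err_ge0.
- by move=> w; exact: powR_ge0.
- exact: (measurable_drift_error_powR X p (ltW H0) (ltW l0) r0 A3).
- exact: (measurable_drift_error_powR X p (ltW H0) (ltW l0) rm0 A3).
- exact: measurable_enorm_powR.
- move=> w.
  have := @drift_error_powR_le_error R d b L H l p p0 m n (X w) H0 l0 p_gt0
    p0_gt0 r3 mn (drift_rest_growth A3).
  by rewrite powR_add1_trunc_radius !mulrA.
Qed.

(** Degenerate case, treated apart because the general constant divides by the moment of [X]: here
    [X] vanishes almost surely, and 0 lies in the ball of radius r - 2, where b_n = b. *)
Lemma drift_error_moment_eq0 (R : realType) (d : nat)
    (disp : measure_display) (Omega : measurableType disp)
    (P : probability Omega R) (X : {RV P >-> borel_rV R d})
    (b : 'rV[R]_d -> 'rV[R]_d) (L H l p p0 : R) (n : nat) :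
  0 < H -> 0 < l -> p != 0 -> 2 <= trunc_radius H l n ->
  (forall x y, enorm (drift_rest b L x - drift_rest b L y)
      <= H * (1 + enorm x + enorm y) `^ l * enorm (x - y)) ->
  abs_moment P p0 X = 0%E ->
  (abs_moment P p (fun w => b (X w) - trunc_drift b L H l n (X w))%R <= 0)%E.
Proof.
move=> H0 l0 p_neq0 r2 A3 X0; rewrite -[leRHS]X0 !abs_momentE.
have r0 : 0 <= trunc_radius H l n by lra.
have mX := measurable_enorm_powR X p0.
apply: ae_ge0_le_integral => //.
- by move=> w _; rewrite lee_fin powR_ge0.
- exact: (measurable_drift_error_powR X p (ltW H0) (ltW l0) r0 A3).
- by move=> w _; rewrite lee_fin powR_ge0.
have : ae_eq P setT (fun w => (enorm (X w) `^ p0)%:E) (cst 0%E).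
  apply/(ae_eq_integral_abs P measurableT mX).
  rewrite -[RHS]X0 abs_momentE; apply: eq_integral => w _.
  by rewrite gee0_abs // lee_fin powR_ge0.
apply: filterS => w /(_ I) /= [/powR_eq0_eq0 Xw] _; rewrite lee_fin.
rewrite [X in X `^ p](_ : _ = 0) ?powR0 ?powR_ge0 //.
by apply: drift_error_eq0; rewrite Xw subr_ge0.
Qed.

Unset Implicit Arguments.

(** Claim (iii) has two forms. If (l + 1) p <= p0, the constant is a function of the moment alone.
    Otherwise the error, which may grow like |x|^(l+1), can have an infinite moment of order p; the
    second form therefore assumes these moments finite, and its constant may depend on [X]. *)
Theorem proposition3p2 (R : realType) (d : nat)
  (disp : measure_display) (Omega : measurableType disp)
  (P : probability Omega R)
  (mnorm : 'M[R]_d -> R) (mnorm_norm : is_norm mnorm)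
  (b : 'rV[R]_d -> 'rV[R]_d) (sigma : 'rV[R]_d -> 'M[R]_d)
  (eta : {RV P >-> borel_rV R d})
  (L c p0 H l : R)
  (L_gt0 : 0 < L) (c_gt0 : 0 < c) (p0_gt0 : 0 < p0) (H_gt0 : 0 < H)
  (l_gt0 : 0 < l)
  (A1b : forall x y : 'rV[R]_d, dotp (b x - b y) (x - y) <= - L * enorm (x - y) ^+ 2)
  (A1sigma : forall x y : 'rV[R]_d, mnorm (sigma x - sigma y) <= c * enorm (x - y))
  (A2 : (abs_moment P p0 eta < +oo)%E)
  (A3 : forall x y : 'rV[R]_d,
    enorm (drift_rest b L x - drift_rest b L y)
      <= H * (1 + enorm x + enorm y) `^ l * enorm (x - y)) :
  exists m : nat,
    [/\ forall n, (m <= n)%N -> 2 <= trunc_radius H l n,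
        forall n, (m <= n)%N -> forall x y : 'rV[R]_d,
          dotp (trunc_drift b L H l n x - trunc_drift b L H l n y) (x - y)
            <= - L * enorm (x - y) ^+ 2,
        forall n, (m <= n)%N -> forall x : 'rV[R]_d,
          enorm (trunc_drift b L H l n x)
            <= L * enorm x
               + n%:R `^ (2^-1) * (1 + Num.min (enorm x) (trunc_radius H l n)) &
        forall p : R, 0 < p ->
          ((l + 1) * p <= p0 ->
            exists C : R -> R, (forall v, 0 < C v) /\
              forall X : {RV P >-> borel_rV R d},
              (abs_moment P p0 X < +oo)%E ->
              forall n, (m <= n)%N ->
              (abs_moment P p (fun w => b (X w) - trunc_drift b L H l n (X w))%R
               <= (C (fine (abs_moment P p0 X))
                   * n%:R `^ (((l + 2) * p - p0) / (2 * (l + 1))))%R%:E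
                  * abs_moment P p0 X)%E) /\
          (forall X : {RV P >-> borel_rV R d},
            (abs_moment P p0 X < +oo)%E ->
            (forall n, (m <= n)%N ->
              (abs_moment P p (fun w => b (X w) - trunc_drift b L H l n (X w))%R
               < +oo)%E) ->
            exists C : R, 0 < C /\
              forall n, (m <= n)%N ->
              (abs_moment P p (fun w => b (X w) - trunc_drift b L H l n (X w))%R
               <= (C * n%:R `^ (((l + 2) * p - p0) / (2 * (l + 1))))%R%:E
                  * abs_moment P p0 X)%E)].
Proof.
have g_le := drift_rest_growth A3.
(* The 3 serves the tail estimates; the other summand makes H (1 + r)^l at least |b(0)|. *)
have [m m_le] := trunc_radius_unbounded (3 + (enorm (b 0) / H) `^ l^-1) H_gt0 l_gt0.
have y_ge0 : 0 <= (enorm (b 0) / H) `^ l^-1 by exact: powR_ge0.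
have r3 n : (m <= n)%N -> 3 <= trunc_radius H l n by move=> /m_le; lra.
have r2 n : (m <= n)%N -> 2 <= trunc_radius H l n by move=> /m_le; lra.
have b0_le n : (m <= n)%N -> enorm (b 0) <= H * (1 + trunc_radius H l n) `^ l.
  move=> mn; rewrite -ler_pdivrMl // mulrC.
  have bH0 : 0 <= enorm (b 0) / H by rewrite divr_ge0 ?enorm_ge0 ?ltW.
  rewrite -[leLHS]powRr1 // -[X in _ `^ X](@mulVf _ l) ?gt_eqF // powRrM.
  apply: ge0_ler_powR; rewrite ?nnegrE ?(ltW l_gt0) ?add1_trunc_radius_ge0 //.
  by have := m_le n mn; lra.
exists m; split => [//|n mn|n mn|p p_gt0].
- exact: trunc_drift_monotone (r2 n mn) A1b g_le.
- exact: enorm_trunc_drift_le L_gt0 H_gt0 l_gt0 (r2 n mn) (b0_le n mn) g_le.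
set e := (l + 2) * p - p0.
(* Common form of both constants: [a] is 2 in the direct bound and 4 in the bound through the error
   at [m]. *)
pose K a := (a * H) `^ p * 4 `^ p0 * H `^ (- (l + 1)^-1 * e).
have K_gt0 a : 0 < a -> 0 < K a by move=> a0; rewrite !mulr_gt0 ?powR_gt0 ?mulr_gt0.
split=> [lp|X X_fin err_fin].
  exists (fun=> K 2); split=> [_|X X_fin n mn]; first exact: K_gt0.
  exact: (drift_error_moment_le X H_gt0 l_gt0 p_gt0 lp (r3 n mn) A3).
have [lp|lp] := leP ((l + 1) * p) p0.
  exists (K 2); split=> [|n mn]; first exact: K_gt0.
  exact: (drift_error_moment_le X H_gt0 l_gt0 p_gt0 lp (r3 n mn) A3).
have fin_momentE q (Y : Omega -> 'rV[R]_d) : (abs_moment P q Y < +oo)%E ->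
    exists2 v, 0 <= v & abs_moment P q Y = v%:E.
  move=> Y_fin; have Y_ge0 := abs_moment_ge0 P q Y.
  by exists (fine (abs_moment P q Y)); rewrite ?fine_ge0 // fineK ?ge0_fin_numE.
have [A A_ge0 XE] := fin_momentE _ _ X_fin.
have [B B_ge0 BE] := fin_momentE _ _ (err_fin m (leqnn m)).
have [A0|A_neq0] := eqVneq A 0.
  have X0 : abs_moment P p0 X = 0%E by rewrite XE A0.
  exists 1; split=> // n mn; rewrite X0 mule0.
  by apply: drift_error_moment_eq0 (r2 n mn) A3 X0; rewrite ?gt_eqF.
have A_gt0 : 0 < A by rewrite lt0r A_neq0.
(* [B] is the moment of the error at [m]; the division by [A] is undone by the factor [A] on the
   right-hand side. *)
exists (2 `^ p * B / A + K 4); split=> [|n mn].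
  by rewrite ltr_wpDl ?K_gt0 // divr_ge0 ?mulr_ge0 ?powR_ge0 // ltW.
apply: (le_trans (drift_error_moment_le_error X H_gt0 l_gt0 p_gt0 p0_gt0
  (r3 m (leqnn m)) mn A3)).
rewrite BE XE -!EFinM -EFinD lee_fin -/e.
set n_e := n%:R `^ _.
(* The exponent is nonnegative because p0 < (l + 1) p < (l + 2) p; hence the power of n absorbs the
   constant term 2^p B. *)
have n_e1 : 1 <= n_e.
  have n_gt0 : (0 < n)%N.
    by apply: (@trunc_radius_gt0 _ H l) => //; have := r2 n mn; lra.
  rewrite -[leLHS](powRr0 n%:R) ler_powR ?ler1n // divr_ge0 /e //; nra.
rewrite -/(K 4) (mulrDl _ _ n_e) mulrDl lerD2r mulrAC divfK ?gt_eqF //.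
by rewrite ler_peMr // mulr_ge0 ?powR_ge0.
Qed.
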